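(* Let $0<\alpha<1$. There exist a dense $G_\delta$ set $\Lambda\subset[0,1)$ and a set $Y\subset X$ with $\mu_\alpha(Y)=1$ such that for every $\theta\in\Lambda$ and every $x\in Y$ the set $\{e^{2\pi i\, d_j(x)\theta}: j\in\mathbb N\}$ is dense in the unit circle $S^1$, but the sequence $(e^{2\pi i\, d_j(x)\theta})_{j\in\mathbb N}$ is not uniformly distributed in $S^1$.
   Context: The Pascal graph is the directed infinite graph with vertices $(n,k)$, $n=0,1,2,\dots$, $0\le k\le n$, with two edges leaving each vertex $(n,k)$: one to $(n+1,k)$, labelled $0$, and one to $(n+1,k+1)$, labelled $1$. $X$ is the space of infinite paths starting at the root $(0,0)$; reading edge labels identifies $X$ with $\Omega=\{0,1\}^{\mathbb N}$ (with its product $\sigma$-algebra). For $x\in X$, $k_n(x)$ is the number of $1$'s among the first $n$ labels of $x$, so the $n$-th vertex of $x$ is $(n,k_n(x))$, and $d_n(x)=\binom{n}{k_n(x)}$. For $0<\alpha<1$, $\mu_\alpha=\mathcal B(\alpha,1-\alpha)$ is the Bernoulli product measure on $X=\{0,1\}^{\mathbb N}$ for which the coordinates are independent, each equal to $0$ with probability $\alpha$ and to $1$ with probability $1-\alpha$. The interval $[0,1)$ carries its usual topology; uniform distribution in $S^1$ is equidistribution with respect to normalized arc length (equivalently, uniform distribution of $(d_j(x)\theta)_j$ modulo 1). *)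

(* Defs.v *)
From mathcomp Require Import all_boot all_order all_algebra.
From mathcomp Require Import finmap.
From mathcomp Require Import complex.
From mathcomp Require Import all_classical all_reals all_analysis.

Set Implicit Arguments.
Unset Strict Implicit.
Unset Printing Implicit Defensive.

Import Order.TTheory GRing.Theory Num.Theory.
Import numFieldNormedType.Exports.

Local Open Scope classical_set_scope.
Local Open Scope ring_scope.

(* A path of the Pascal graph is the sequence of its edge labels, with
   label 1 encoded as true; these sets generate the product sigma-algebra. *)
Definition path_coord_sets : set (set (nat -> bool)) :=
  [set A | exists (i : nat) (b : bool), A = [set x | x i = b]].

Notation path_space := (g_sigma_algebraType path_coord_sets).

Definition pascal_k (n : nat) (x : path_space) : nat :=
  (\sum_(i < n) x i)%N.

Definition pascal_d (n : nat) (x : path_space) : nat := 'C(n, pascal_k n x).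

Definition independent_labels (R : realType)
    (P : probability path_space R) : Prop :=
  forall (J : {fset nat}) (B : nat -> set bool),
    P [set x | forall i, i \in J -> B i (x i)] =
    (\prod_(i <- J) P [set x | B i (x i)])%E.

Definition is_bernoulli (R : realType) (alpha : R)
    (P : probability path_space R) : Prop :=
  [/\ independent_labels P,
      forall i, P [set x | x i = false] = alpha%:E &
      forall i, P [set x | x i = true] = (1 - alpha)%:E].

Definition dense_in (T : topologicalType) (S A : set T) : Prop :=
  S `<=` A /\ A `<=` closure S.

(* t |-> e^(2 pi i t) *)
Definition e2pi (R : realType) (t : R) : R[i]^o :=
  Complex (cos (2 * pi * t)) (sin (2 * pi * t)).

Definition circle (R : realType) : set R[i]^o := [set z | `|z| = 1].

(* For a <= b <= a + 1 this is an arc of normalized length b - a. *)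
Definition circle_arc (R : realType) (a b : R) : set R[i]^o :=
  (@e2pi R) @` `[a, b[.

Definition unif_distributed_circle (R : realType) (z : nat -> R[i]^o) : Prop :=
  forall a b : R, a <= b -> b <= a + 1 ->
    (fun N : nat => (\sum_(j < N) \1_(circle_arc a b) (z j)) / N%:R : R) @ \oo
      --> b - a.

(* Main.v *)
Require Import Defs.
From mathcomp Require Import all_boot all_order all_algebra.
From mathcomp Require Import finmap complex zify ring lra.
From mathcomp Require Import all_classical all_reals all_analysis borel_hierarchy.

Set Implicit Arguments.
Unset Strict Implicit.
Unset Printing Implicit Defensive.

Import Order.TTheory GRing.Theory Num.Theory.
Import numFieldNormedType.Exports.

Local Open Scope classical_set_scope.
Local Open Scope ring_scope.

                                                                                      
                                                                                        
                                                                                  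
                                                                                        
                                                                                   
                                                                                          
                                                                                         
                                                                                                                                                 
                                                                                    
                                                                               

(** Modulo a prime [l], Pascal's triangle is explicit near row [l ^ M]. Below that row hangs an
    inverted triangle of zeros ([prime_dvd_bin_pow_add]). By Chebyshev, a typical path enters it far
    from its sides and stays there for a number of steps proportional to [l ^ M]. Hence, for some
    large N, a fraction at least 1/K of the first N values d_j is divisible by [l], with K depending
    on alpha only ([mu_window]). Two rows above row [l ^ M] the entries are (-1)^k (k+1)
    ([bin_pow_pred2]), and for [l] odd a path given many such rows is likely to meet every residue
    modulo [l] ([mu_miss_residue]). Both events happen before a finite time J, outside a set of
    small measure ([bernoulli_stage]).

    If theta is within 1/(2^J l) of p/l, with p prime to l, then d_j theta is within 1/l of d_j p/l
    for all j up to J. So the orbit comes 2/l-close to every point of the circle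
    ([pascal_d_rotation]), yet at time N a fraction 1/K of it lies within 1/l of the point 1
    ([pascal_d_return]), in normalized arc length. By Baire, the angles approximated in this way at
    infinitely many stages form a dense G_delta ([dense_in_well_approx]); by Borel-Cantelli, almost
    every path is good at all late stages ([lim_sup_set_null]). As l grows, the first property gives
    density and the second gives too many visits to an arc around 1 of length less than 1/K. *)

(** * Binomial coefficients modulo a prime, near row [l ^ M] *)

(** From k C(n,k) = n C(n-1,k-1) with n = [l ^ M]: were the coefficient prime to [l], then [l ^ M]
    would divide [k], which is too small. *)
Lemma prime_dvd_bin_pow (l M k : nat) :
  prime l -> (0 < k < l ^ M)%N -> (l %| 'C(l ^ M, k))%N.
Proof.
move=> pl /andP[k0 kM]; apply/negPn/negP => ndvd.
have lM0 : (0 < l ^ M)%N by rewrite expn_gt0 prime_gt0.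
have := mul_bin_diag (l ^ M) k.-1; rewrite prednK // => e.
have : (l ^ M %| k * 'C(l ^ M, k))%N by rewrite -e dvdn_mulr.
rewrite Gauss_dvdl; last by rewrite coprimeXl // prime_coprime.
by move=> /(dvdn_leq k0); rewrite leqNgt kM.
Qed.

(** Pascal's rule propagates the zeros of row [l ^ M] downwards, losing one at the left end at each
    row: this is the inverted triangle of zeros. *)
Lemma prime_dvd_bin_pow_add (l M i k : nat) :
  prime l -> (i < k < l ^ M)%N -> (l %| 'C(l ^ M + i, k))%N.
Proof.
move=> pl; elim: i k => [|i IH] k; first by rewrite addn0; exact: prime_dvd_bin_pow.
case: k => [//|k] /andP[ik kM]; rewrite addnS binS dvdn_add // IH //.
  by rewrite (ltnW ik).
by rewrite -ltnS ik ltnW.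
Qed.

(** Neighbouring entries of this row add up to an entry of row [l ^ M], which is zero modulo [l]; so
    the signs alternate. *)
Lemma bin_pow_pred (l M k : nat) : prime l -> (k < l ^ M)%N ->
  ('C((l ^ M).-1, k)%:R = (-1) ^+ k :> 'F_l).
Proof.
move=> pl; have lM0 : (0 < l ^ M)%N by rewrite expn_gt0 prime_gt0.
elim: k => [|k IH] kM; first by rewrite bin0 expr0.
have /dvdnP[q e] : (l %| 'C(l ^ M, k.+1))%N by exact: prime_dvd_bin_pow.
move: e; rewrite -{1}(prednK lM0) binS => /(congr1 (fun n => n%:R : 'F_l)).
rewrite natrD natrM IH; last exact: ltnW.
have -> : (l%:R : 'F_l) = 0 by apply/eqP; rewrite -(dvdn_pcharf (pchar_Fp pl)).
rewrite mulr0 => /eqP; rewrite addr_eq0 => /eqP ->.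
by rewrite exprS mulN1r.
Qed.

(** Neighbouring entries now add up to the alternating signs of the next row. Unlike that row, this
    one can take every residue. *)
Lemma bin_pow_pred2 (l M k : nat) : prime l -> (k.+1 < l ^ M)%N ->
  ('C((l ^ M).-2, k)%:R = (-1) ^+ k * k.+1%:R :> 'F_l).
Proof.
move=> pl; elim: k => [|k IH] kM; first by rewrite bin0 expr0 mulr1.
have := @bin_pow_pred l M k.+1 pl (ltnW kM).
rewrite -[in X in X -> _](prednK (n := (l ^ M).-1)); last lia.
rewrite binS natrD IH ?(ltnW kM) //.
by move=> /(canRL (addrK _)) ->; rewrite -[k.+2]addn1 natrD exprS; ring.
Qed.

(** * Expectations over finite words of independent labels *)

Section words.
Context {R : realFieldType}.
Variable a : R.

Definition label_pr (b : bool) : R := if b then 1 - a else a.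
Arguments label_pr : simpl never.

(** The expectation of [f] over [m] independent labels. All events estimated below depend on
    finitely many labels, so this finite recursion replaces integration. *)
Fixpoint wordE (m : nat) (f : seq bool -> R) : R :=
  if m is m'.+1 then
    label_pr false * wordE m' (fun w => f (false :: w)) +
    label_pr true * wordE m' (fun w => f (true :: w))
  else f [::].

Lemma eq_wordE m f g : (forall w, size w = m -> f w = g w) -> wordE m f = wordE m g.
Proof.
elim: m f g => [|m IH] f g fg /=; first exact: fg.
by congr (_ * _ + _ * _); apply: IH => w sw; apply: fg => /=; rewrite sw.
Qed.

Lemma wordE_lin m f g u v :
  wordE m (fun w => u * f w + v * g w) = u * wordE m f + v * wordE m g.
Proof.
elim: m f g => [|m IH] f g //=; rewrite 2!IH; ring.
Qed.

Lemma wordE_cst m u : wordE m (fun=> u) = u.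
Proof. elim: m => [|m IH] //=; rewrite IH /label_pr; ring. Qed.

Lemma wordEM m u f : wordE m (fun w => u * f w) = u * wordE m f.
Proof. elim: m f => [|m IH] f //=; rewrite !IH; ring. Qed.

Lemma wordE_cat m n f :
  wordE (m + n) f = wordE m (fun w => wordE n (fun v => f (w ++ v))).
Proof. by elim: m f => [|m IH] f //=; rewrite !IH. Qed.

(** The variance of the number of ones. The shift [u] makes the induction work: the first label
    moves it by [a] or by [-(1 - a)], a step of mean zero and variance [a * (1 - a)]. *)
Lemma wordE_sqdev m u :
  wordE m (fun w => (u + (count id w)%:R - (1 - a) * m%:R) ^+ 2)
  = u ^+ 2 + m%:R * (a * (1 - a)).
Proof.
elim: m u => [|m IH] u /=; first by ring.
rewrite (@eq_wordE m _ (fun w => (u - (1 - a) + (count id w)%:R - (1 - a) * m%:R) ^+ 2));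
  last by move=> w _; rewrite -[m.+1]addn1 !natrD /=; ring.
rewrite [X in _ + _ * X](@eq_wordE m _ (fun w => (u + a + (count id w)%:R - (1 - a) * m%:R) ^+ 2));
  last by move=> w _; rewrite -[m.+1]addn1 !natrD /=; ring.
rewrite !IH /label_pr -[m.+1]addn1 natrD; ring.
Qed.

Hypothesis a01 : 0 < a < 1.

Lemma label_pr_gt0 b : 0 < label_pr b.
Proof. by case/andP: a01 => a0 a1; rewrite /label_pr; case: b; lra. Qed.

Lemma le_wordE m f g : (forall w, size w = m -> f w <= g w) -> wordE m f <= wordE m g.
Proof.
elim: m f g => [|m IH] f g fg /=; first exact: fg.
by apply: lerD; (rewrite ler_pM2l; last exact: label_pr_gt0);
  apply: IH => w sw; apply: fg => /=; rewrite sw.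
Qed.

(** A single word with [t] ones already suffices, since each of its labels has probability at least
    [a * (1 - a)]. The bound is uniform in [t]. *)
Lemma wordE_count_ge t q : (t <= q)%N ->
  (a * (1 - a)) ^+ q <= wordE q (fun w => (count id w == t)%:R).
Proof.
have a0 : 0 < a by case/andP: a01.
have a1 : 0 < 1 - a by rewrite subr_gt0; case/andP: a01.
elim: q t => [|q IH] t; first by rewrite leqn0 => /eqP ->; rewrite expr0.
have nn b s : 0 <= label_pr b * wordE q (fun w => (count id (b :: w) == s)%:R).
  rewrite mulr_ge0 ?(ltW (label_pr_gt0 _)) // -(wordE_cst q 0).
  by apply: le_wordE => w _; rewrite ler0n.
have p0 : 0 <= (a * (1 - a)) ^+ q by rewrite exprn_ge0 // ltW // mulr_gt0.
case: t => [_|t tq].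
  apply: (@le_trans _ _ (label_pr false * wordE q (fun w => (count id w == 0%N)%:R))).
    rewrite exprS ler_pM ?IH //; first by rewrite mulr_ge0 ?ltW.
    by rewrite /label_pr; nra.
  by rewrite /= lerDl; exact: (nn true 0%N).
apply: (@le_trans _ _ (label_pr true * wordE q (fun w => (count id w == t)%:R))).
  rewrite exprS ler_pM ?IH //; first by rewrite mulr_ge0 ?ltW.
  by rewrite /label_pr; nra.
by rewrite /= lerDr; exact: (nn false t.+1).
Qed.

End words.

(** * The Bernoulli measure of events depending on finitely many labels *)

Lemma measurable_label (i : nat) (b : bool) :
  measurable ([set x | x i = b] : set path_space).
Proof. by apply: sub_sigma_algebra; exists i, b. Qed.

Lemma mkseq_rconsE (x : path_space) (w : seq bool) (b : bool) :
  mkseq x (size w).+1 = rcons w b <-> mkseq x (size w) = w /\ x (size w) = b.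
Proof.
rewrite mkseqS; split; first by move/rcons_inj => [].
by move=> [-> ->].
Qed.

Lemma pascal_k_count (n : nat) (x : path_space) :
  pascal_k n x = count id (mkseq x n).
Proof.
rewrite /pascal_k; elim: n => [|n IH]; first by rewrite big_ord0.
by rewrite big_ord_recr mkseqS -cats1 count_cat IH /= addn0.
Qed.

Lemma measurable_cylinder (w : seq bool) :
  measurable ([set x | mkseq x (size w) = w] : set path_space).
Proof.
elim/last_ind: w => [|w b IH].
  by rewrite (_ : [set x | _] = setT)//; apply/seteqP; split.
rewrite (_ : [set x | _] = [set x | mkseq x (size w) = w] `&` [set x | x (size w) = b]).
  by apply: measurableI => //; exact: measurable_label.
by apply/seteqP; split => x /=; rewrite size_rcons => /mkseq_rconsE.
Qed.

Section bernoulli.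
Context {R : realType} {a : R} (mu : probability path_space R).
Hypothesis hmu : is_bernoulli a mu.

Lemma mu_cylinder (w : seq bool) :
  mu [set x | mkseq x (size w) = w] = (\prod_(b <- w) label_pr a b)%:E.
Proof.
case: hmu => ind mu0 mu1.
pose J := [fset i in iota 0 (size w)]%fset.
have := ind J (fun i => [set nth false w i]).
have pJ : perm_eq J (iota 0 (size w)).
  apply: uniq_perm => [||i]; first exact: fset_uniq.
    exact: iota_uniq.
  by rewrite !inE.
rewrite (perm_big _ pJ) /= => e.
transitivity (mu [set x | forall i, i \in J -> [set nth false w i] (x i)]).
  congr (mu _); apply/seteqP; split => x /=.
    move=> xw i; rewrite !inE mem_iota add0n => /andP[_ iw].
    by rewrite -[in RHS]xw nth_mkseq.
  move=> xw; apply: (@eq_from_nth _ false); rewrite size_mkseq // => i iw.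
  by rewrite nth_mkseq // xw // !inE mem_iota.
rewrite e big_seq.
under eq_bigr => i _.
  rewrite (_ : mu _ = (label_pr a (nth false w i))%:E); last first.
    by case: (nth false w i); rewrite ?mu0 ?mu1.
  over.
rewrite -big_seq prodEFin; congr EFin.
by rewrite [RHS](big_nth false) /index_iota subn0.
Qed.

(** Splitting on the next label lengthens the fixed prefix by one, whence the general [w]; only the
    empty prefix is used in the end. *)
Lemma mu_mkseq_prefix (w : seq bool) (m : nat) (Q : pred (seq bool)) :
  let A := [set x | mkseq x (size w) = w /\ Q (mkseq x (size w + m))] in
  measurable (A : set path_space) /\
  mu A = ((\prod_(b <- w) label_pr a b) * wordE a m (fun v => (Q (w ++ v))%:R))%:E.
Proof.
elim: m w => [|m IH] w A.
  rewrite /= cats0; have [Qw|Qw] := boolP (Q w).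
    have -> : A = [set x | mkseq x (size w) = w].
      by apply/seteqP; split => x /=; rewrite /A /= addn0; [case|move=> ->].
    by rewrite mulr1 mu_cylinder; split => //; exact: measurable_cylinder.
  have -> : A = set0.
    apply/seteqP; split => x //=; rewrite /A /= addn0 => -[-> Qw'].
    by rewrite Qw' in Qw.
  by rewrite mulr0 measure0; split.
have [m0 e0] := IH (rcons w false); have [m1 e1] := IH (rcons w true).
have -> : A = [set x | mkseq x (size (rcons w false)) = rcons w false /\
       Q (mkseq x (size (rcons w false) + m))] `|`
   [set x | mkseq x (size (rcons w true)) = rcons w true /\
       Q (mkseq x (size (rcons w true) + m))].
  apply/seteqP; split => x; rewrite /A /= !size_rcons !addSn -addnS.
    by case=> xw Qx; case E: (x (size w)); [right|left]; split=> //; apply/mkseq_rconsE.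
  by case=> -[/mkseq_rconsE[? _] ?].
split; first exact: measurableU.
rewrite measureU //; last first.
  apply/seteqP; split => x //= -[[+ _] [+ _]].
  by rewrite !size_rcons => /mkseq_rconsE[_ e] /mkseq_rconsE[_]; rewrite e.
apply: etrans (congr2 adde e0 e1) _; rewrite [LHS]/=; congr EFin; rewrite !big_rcons /=.
have E b : wordE a m (fun v => (Q (rcons w b ++ v))%:R) =
           wordE a m (fun v => (Q (w ++ b :: v))%:R).
  by apply: eq_wordE => v _; rewrite cat_rcons.
rewrite !E; ring.
Qed.

Lemma mu_mkseq (m : nat) (Q : pred (seq bool)) :
  measurable ([set x | Q (mkseq x m)] : set path_space) /\
  mu [set x | Q (mkseq x m)] = (wordE a m (fun v => (Q v)%:R))%:E.
Proof.
have := mu_mkseq_prefix [::] m Q; rewrite big_nil mul1r /=.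
rewrite (_ : [set x | _] = [set x | Q (mkseq x m)]) //.
apply/seteqP; split => x /=; first by case.
by move=> Qx; split.
Qed.

End bernoulli.

(** * Probability of missing a residue, and Chebyshev's bound *)

Section word_estimates.
Context {R : realFieldType}.
Variable a : R.
Hypothesis a01 : 0 < a < 1.

(** Condition on the first [g - q] labels: whatever count they produce, a suitable number of ones
    among the last [q] labels hits the residue. *)
Lemma wordE_miss_residue (q r0 c g : nat) : (r0 < q <= g)%N ->
  wordE a g (fun w => (((c + count id w) %% q)%N != r0)%:R) <= 1 - (a * (1 - a)) ^+ q.
Proof.
move=> /andP[rq qg]; rewrite -(subnK qg) wordE_cat -[leRHS](wordE_cst a (g - q)).
apply: (le_wordE a01) => u _; set d := (c + count id u)%N.
(* The number of further ones, below [q], that brings the count [d] to [r0] modulo [q]. *)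
pose t := ((r0 + (q - d %% q)) %% q)%N.
have tq : (t < q)%N by rewrite ltn_mod; lia.
have dt : ((d + t) %% q = r0)%N.
  have dq := ltn_pmod d (leq_ltn_trans (leq0n _) rq).
  rewrite /t modnDmr {1}(divn_eq d q).
  rewrite (_ : (_ + _ = (d %/ q).+1 * q + r0)%N); last first.
    rewrite mulSn; move: (d %/ q * q)%N (d %% q)%N dq => A B; lia.
  by rewrite modnMDl modn_small.
apply: (@le_trans _ _ (wordE a q (fun v => 1 * 1 + (-1) * (count id v == t)%:R))).
  apply: (le_wordE a01) => v _; rewrite count_cat addnA -/d.
  have [->|] := eqVneq (count id v) t; first by rewrite dt eqxx mulr1 mulN1r subrr.
  by move=> _; rewrite mulr1 mulN1r subr0 lern1 leq_b1.
rewrite (wordE_lin a q (fun=> 1) (fun v => (count id v == t)%:R)) wordE_cst.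
have := wordE_count_ge a01 (ltnW tq); lra.
Qed.

(** Levels at least [q] apart give each level a fresh chance: conditionally on the past, the residue
    is missed with probability at most the same factor. *)
Lemma wordE_miss_levels (q r0 : nat) (n : nat -> nat) (r : nat) :
  (r0 < q)%N -> (forall i, (n i + q <= n i.+1)%N) ->
  wordE a (n r) (fun w =>
    (all (fun i => (count id (take (n i.+1) w) %% q)%N != r0) (iota 0 r))%:R)
  <= (1 - (a * (1 - a)) ^+ q) ^+ r.
Proof.
move=> rq nq; elim: r => [|r IH].
  by rewrite expr0 /= wordE_cst.
have nr := nq r; have nle := leq_trans (leq_addr _ _) nr.
rewrite -[in X in wordE _ X](subnKC nle) wordE_cat exprSr.
set G := fun w => (all _ (iota 0 r))%:R in IH.
rewrite -[leRHS]mulrC.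
apply: (@le_trans _ _ (wordE a (n r) (fun w => (1 - (a * (1 - a)) ^+ q) * G w))).
  apply: (le_wordE a01) => w sw.
  rewrite (@eq_wordE _ _ _ _ (fun v => G w * (((count id w + count id v) %% q)%N != r0)%:R)).
    rewrite wordEM mulrC ler_wpM2r ?ler0n //.
    by apply: wordE_miss_residue; rewrite rq; lia.
  move=> v sv; rewrite -addn1 iotaD all_cat /= add0n andbT -natrM mulnb.
  rewrite take_oversize ?size_cat ?count_cat; last by rewrite sw sv subnKC.
  congr (_ && _)%:R; apply: eq_in_all => i; rewrite mem_iota => /andP[_ ir].
  rewrite takel_cat // sw.
  have h : {homo n : i j / (i <= j)%N}.
    apply: homo_leq => [//|y x z|j]; first exact: leq_trans.
    exact: leq_trans (leq_addr _ _) (nq j).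
  exact: h.
rewrite wordEM ler_wpM2l // subr_ge0 exprn_ile1 //.
  by case/andP: a01 => ? ?; nra.
by case/andP: a01 => ? ?; nra.
Qed.

(** Chebyshev: the mean [(1 - a) * n] is at least [2 * c * n] from both 0 and [n], so a count
    outside the window deviates by at least [c * n], while the variance is at most [n]. *)
Lemma wordE_tail (c : R) (n m : nat) : 0 < c -> 2 * c <= a -> 2 * c <= 1 - a ->
  (0 < n)%N -> m%:R <= c * n%:R ->
  wordE a n (fun w => (~~ (m <= count id w <= n - m)%N)%:R) <= (c ^+ 2 * n%:R)^-1.
Proof.
move=> c0 ca cb n0 mc; have nR : 0 < n%:R :> R by rewrite ltr0n.
have cn : 0 < c * n%:R by rewrite mulr_gt0.
apply: (@le_trans _ _ (wordE a n (fun w =>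
   ((c * n%:R) ^- 2) * (0 + (count id w)%:R - (1 - a) * n%:R) ^+ 2))).
  apply: (le_wordE a01) => w sw.
  have : (count id w <= n)%N by rewrite -sw count_size.
  set k := count id w => kn.
  have [/andP[mk km]|kP] := boolP (m <= k <= n - m)%N.
    by rewrite mulr_ge0 ?sqr_ge0 // invr_ge0 exprn_ge0 // ltW.
  rewrite mulrC ler_pdivlMr ?exprn_gt0 // mul1r add0r.
  have {}kP : ((k < m) || (n < k + m))%N by lia.
  rewrite -[leRHS]real_normK ?num_real // ler_pXn2r ?nnegrE ?normr_ge0 ?(ltW cn) //.
  case/orP: kP => [km|km].
    rewrite ler0_norm //; last first.
    have : k%:R <= m%:R :> R by rewrite ler_nat ltnW.
      nra.
    have : k%:R <= m%:R :> R by rewrite ler_nat ltnW.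
    nra.
  have {}km : n%:R <= k%:R + m%:R :> R by rewrite -natrD ler_nat ltnW.
  rewrite ger0_norm //; nra.
rewrite wordEM wordE_sqdev expr0n add0r.
rewrite (_ : (_ * _) = (c ^+ 2 * n%:R)^-1 * (a * (1 - a))).
  rewrite ler_piMr // ?invr_ge0 ?mulr_ge0 ?exprn_ge0 ?(ltW c0) ?(ltW nR) //.
  by case/andP: a01 => ? ?; nra.
by field; rewrite !gt_eqF.
Qed.

End word_estimates.

(** * Divisibility and residues of d_j along a path *)

Lemma pascal_k_add (n i : nat) (x : path_space) :
  (pascal_k n x <= pascal_k (n + i) x <= pascal_k n x + i)%N.
Proof.
elim: i => [|i IH]; first by rewrite !addn0 leqnn.
rewrite addnS /pascal_k big_ord_recr /= -!/(pascal_k _ _).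
by case: (x _); lia.
Qed.

Lemma pascal_k_le (n : nat) (x : path_space) : (pascal_k n x <= n)%N.
Proof. by have /andP[_] := pascal_k_add 0 n x; rewrite /pascal_k big_ord0. Qed.

(** A path crossing row [l ^ M] at distance at least [m] from both ends stays inside the triangle of
    zeros for [m] steps. *)
Lemma sum_dvd_pascal_d_window (l M m : nat) (x : path_space) : prime l ->
  (m <= pascal_k (l ^ M) x <= l ^ M - m)%N -> (m <= l ^ M)%N ->
  (m <= \sum_(j < l ^ M + m) (l %| pascal_d j x))%N.
Proof.
move=> pl /andP[mk km] mn.
rewrite big_split_ord /= (leq_trans _ (leq_addl _ _)) //.
rewrite (eq_bigr (fun=> 1%N)) ?sum1_card ?card_ord // => i _.
rewrite prime_dvd_bin_pow_add //.
have /andP[h1 h2] := pascal_k_add (l ^ M) i x.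
by have := ltn_ord i; lia.
Qed.

(** For odd [l], the even residue r modulo [2 * l] with r + 1 = u modulo [l]. Working modulo [2 * l]
    fixes both the sign and the size of (-1)^k (k+1). *)
Definition target_residue (l u : nat) : nat := if odd u then u.-1 else (u + l).-1.

Lemma target_residue_lt (l u : nat) : (u < l)%N -> (target_residue l u < 2 * l)%N.
Proof. by rewrite /target_residue; case: ifP; lia. Qed.

Lemma pascal_d_residue (l u M : nat) (x : path_space) :
  prime l -> odd l -> (2 <= l ^ M)%N ->
  (pascal_k (l ^ M).-2 x %% (2 * l))%N = target_residue l u ->
  (pascal_d (l ^ M).-2 x = u %[mod l])%N.
Proof.
move=> pl ol M2; rewrite /pascal_d; set k := pascal_k _ _ => kr.
have kl : (k.+1 < l ^ M)%N by have := pascal_k_le (l ^ M).-2 x; rewrite -/k; lia.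
have E : (target_residue l u).+1 = (u + ~~ odd u * l)%N.
  by rewrite /target_residue; case: (boolP (odd u)); case: u {kr} => [|u] //=; have := prime_gt0 pl; lia.
have ek : odd k = false.
  rewrite (divn_eq k (2 * l)) kr oddD !oddM andbF /=.
  have : odd (target_residue l u).+1 = true.
    by rewrite E oddD oddM ol andbT; case: (odd u).
  by rewrite /= => /negbTE.
rewrite -!(val_Fp_nat pl) (bin_pow_pred2 pl kl) -signr_odd ek expr0 mul1r.
congr val; rewrite (divn_eq k (2 * l)) kr -addnS E.
have l0 : (l%:R : 'F_l) = 0 by apply/eqP; rewrite -(dvdn_pcharf (pchar_Fp pl)).
by rewrite !natrD !natrM l0 !mulr0 addr0 add0r.
Qed.

(** * One stage: a prime, a finite horizon and a small exceptional set *)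

Section stage.
Context {R : realType} {a : R} (mu : probability path_space R).
Hypotheses (a01 : 0 < a < 1) (hmu : is_bernoulli a mu).

Lemma count_take_mkseq (x : path_space) (i n : nat) : (i <= n)%N ->
  count id (take i (mkseq x n)) = pascal_k i x.
Proof.
by move=> iln; rewrite pascal_k_count /mkseq -map_take take_iota (minn_idPl iln).
Qed.

Lemma mu_miss_residue (l u : nat) (e : R) : prime l -> odd l -> (u < l)%N -> 0 < e ->
  exists (J : nat) (B : set path_space), [/\ measurable B, (mu B <= e%:E)%E &
    forall x, ~ B x -> exists2 j, (j <= J)%N & (pascal_d j x = u %[mod l])%N].
Proof.
move=> pl ol ul e0; set r0 := target_residue l u; set q := (2 * l)%N.
have l2 : (2 < l)%N by rewrite odd_prime_gt2.
have q0 : (r0 < q)%N by exact: target_residue_lt.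
(* The rows of [bin_pow_pred2]; as [l > 2], consecutive ones are at least [2 * l] apart. *)
pose n i := (l ^ i.+2).-2.
have nq i : (n i + q <= n i.+1)%N.
  have : (l ^ 2 <= l ^ i.+2)%N by rewrite leq_exp2l // ltnW.
  rewrite /n /q [(l ^ i.+3)%N]expnS => h.
  have : (3 * l ^ i.+2 <= l * l ^ i.+2)%N by rewrite leq_mul2r l2 orbT.
  have : (3 * l <= l ^ 2)%N by rewrite expnS expn1 leq_mul2r l2 orbT.
  by move: (l * _)%N => A; lia.
pose z := 1 - (a * (1 - a)) ^+ q.
have [r zr] : exists r, z ^+ r <= e.
  have d0 : 0 < a * (1 - a) by case/andP: a01 => ? ?; rewrite mulr_gt0 ?subr_gt0.
  have z1 : `|z| < 1.
    have : 0 < (a * (1 - a)) ^+ q by rewrite exprn_gt0.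
    have : (a * (1 - a)) ^+ q <= 1.
      by rewrite exprn_ile1 ?(ltW d0) //; case/andP: a01 => ? ?; nra.
    by move=> ? ?; rewrite ltr_norml /z; lra.
  have /cvgrPdist_le /(_ e e0) [r _ /(_ r (leqnn r))] := cvg_expr z1.
  by rewrite sub0r normrN => h; exists r; rewrite (le_trans _ h) // ler_norm.
pose P w := all (fun i => (count id (take (n i.+1) w) %% q)%N != r0) (iota 0 r).
have [mB eB] := mu_mkseq hmu (n r) P.
exists (n r), [set x | P (mkseq x (n r))]; split => //.
  by rewrite eB lee_fin (le_trans _ zr) //; exact: wordE_miss_levels.
move=> x Px; have NP : ~~ P (mkseq x (n r)) by apply/negP.
have [i ir hi] := elimT (@allPn _ _ _) NP.
move: ir hi; rewrite mem_iota add0n => /andP[_ ir] /= /negPn /eqP.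
have nir : (n i.+1 <= n r)%N.
  have h : {homo n : i j / (i <= j)%N}.
    apply: homo_leq => [//|y ? t|j]; first exact: leq_trans.
    exact: leq_trans (leq_addr _ _) (nq j).
  exact: h.
rewrite count_take_mkseq // => kr; exists (n i.+1) => //.
apply: pascal_d_residue => //.
by rewrite (leq_trans _ (leq_pexp2l (prime_gt0 pl) (isT : (1 <= i.+3)%N))) // expn1 ltnW.
Qed.

(** The constant [K] is chosen before [l], [s] and [e]; a fraction shrinking with [l] would not
    contradict uniform distribution. *)
Lemma mu_window : exists K : nat, (0 < K)%N /\
  forall (l s : nat) (e : R), prime l -> 0 < e ->
  exists (N : nat) (B : set path_space), [/\ measurable B, (mu B <= e%:E)%E, (s < N)%N &
    forall x, ~ B x -> (N <= K * \sum_(j < N) (l %| pascal_d j x))%N].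
Proof.
have [a0 a1] := andP a01.
(* Chosen so that [c] = 1/D satisfies both margin conditions of [wordE_tail]. *)
pose D := Num.bound (2 / a + 2 / (1 - a)).
have ha : 0 < 2 / a by rewrite divr_gt0.
have hb : 0 < 2 / (1 - a) by rewrite divr_gt0 ?subr_gt0.
have hD : 2 / a + 2 / (1 - a) < D%:R by apply: archi_boundP; rewrite addr_ge0 ?ltW.
have D0 : 0 < D%:R :> R by lra.
have D0' : (0 < D)%N by rewrite -(ltr0n R).
pose c : R := D%:R^-1.
have c0 : 0 < c by rewrite invr_gt0.
have ca : 2 * c <= a.
  by rewrite ler_pdivrMr // mulrC -ler_pdivrMr //; lra.
have cb : 2 * c <= 1 - a.
  by rewrite ler_pdivrMr // mulrC -ler_pdivrMr ?subr_gt0 //; lra.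
exists (2 * D + 1)%N; split => [|l s e pl e0]; first by rewrite addn1.
(* The three summands ensure, in order, a Chebyshev bound below [e], a time beyond [s], and
   [m > 0]. *)
pose M := (Num.bound (c ^- 2 / e) + s + D)%N.
pose n := (l ^ M)%N; pose m := (n %/ D)%N.
have Mn : (M < n)%N by apply: ltn_expl; exact: prime_gt1.
have nm : (n < m.+1 * D)%N by rewrite /m -ltn_divLR.
have mn : (m * D <= n)%N by exact: leq_trunc_div.
have m1 : (0 < m)%N by rewrite divn_gt0 // (leq_trans _ (ltnW Mn)) // leq_addl.
have n0 : 0 < n%:R :> R by rewrite ltr0n; exact: leq_ltn_trans Mn.
have hn : c ^- 2 / e <= n%:R.
  apply/ltW/(lt_le_trans (archi_boundP _)).
    by rewrite divr_ge0 ?invr_ge0 ?exprn_ge0 ?(ltW c0) ?(ltW e0).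
  by rewrite ler_nat (leq_trans _ (ltnW Mn)) // /M -addnA leq_addr.
pose P (w : seq bool) := ~~ (m <= count id w <= n - m)%N.
have [mB eB] := mu_mkseq hmu n P.
exists (n + m)%N, [set x | P (mkseq x n)]; split => //.
- rewrite eB lee_fin (le_trans (wordE_tail a01 c0 ca cb _ _)) //.
  + exact: leq_ltn_trans Mn.
  + by rewrite /c mulrC ler_pdivlMr // -natrM ler_nat.
  + rewrite -[leRHS]invrK lef_pV2 ?posrE ?invr_gt0 ?mulr_gt0 ?exprn_gt0 //.
    have c2 : 0 < c ^+ 2 by rewrite exprn_gt0.
    have := ler_wpM2l (ltW c2) hn.
    by rewrite mulrA mulfV ?mul1r // gt_eqF.
- by rewrite (leq_trans _ (leq_addr _ _)) // (leq_ltn_trans _ Mn) // /M addnAC leq_addl.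
move=> x Px; have : ~~ P (mkseq x n) by apply/negP.
rewrite /P => /negPn; rewrite -pascal_k_count => h.
have := sum_dvd_pascal_d_window pl h; rewrite -/n => /(_ _) h2.
have {}h2 := h2 (leq_div _ _).
(* As [m > 0], [n < m.+1 * D <= 2 * m * D], hence [n + m <= (2 * D + 1) * m]. *)
apply: (@leq_trans ((2 * D + 1) * m)); last by rewrite leq_mul2l h2 orbT.
by move: (n) (m) m1 nm; clear => n m; nia.
Qed.

End stage.

(** Everything is witnessed by time [J], so an angle close enough to a fraction p/l, in terms of
    [J], inherits it. *)
Definition stage_good (K s l J : nat) (x : path_space) : Prop :=
  (forall u, (u < l)%N -> exists2 j, (j <= J)%N & (pascal_d j x = u %[mod l])%N) /\
  exists N, [/\ (s < N)%N, (N <= J)%N & (N <= K * \sum_(j < N) (l %| pascal_d j x))%N].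

Lemma bernoulli_stage {R : realType} {a : R} (mu : probability path_space R) :
  0 < a < 1 -> is_bernoulli a mu ->
  exists K : nat, (0 < K)%N /\ forall (s : nat) (e : R), 0 < e ->
  exists (l J : nat) (B : set path_space), [/\ prime l, (s < l)%N, measurable B,
    (mu B <= e%:E)%E & forall x, ~ B x -> stage_good K s l J x].
Proof.
move=> a01 hmu; have [K [K0 hK]] := mu_window a01 hmu.
exists K; split=> // s e e0.
have [l sl pl] := prime_above (s + 2).
have l2 : (2 < l)%N by lia.
have ol : odd l by case: (even_prime pl) => // l2'; rewrite l2' in l2.
have e2 : 0 < e / 2 by rewrite divr_gt0.
have l0 : 0 < l%:R :> R by rewrite ltr0n prime_gt0.
have [N [B1 [mB1 eB1 sN hN]]] := hK l s (e / 2) pl e2.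
(* Half of the error goes to the window; the other half is shared equally among the [l] residues. *)
have el : 0 < e / 2 / l%:R by rewrite divr_gt0.
have /boolp.choice[JB hJB] : forall u : nat, exists JB : nat * set path_space,
    measurable JB.2 /\ ((u < l)%N -> (mu JB.2 <= (e / 2 / l%:R)%:E)%E /\
    forall x, ~ JB.2 x -> exists2 j, (j <= JB.1)%N & (pascal_d j x = u %[mod l])%N).
  move=> u.
  have [ul|ul] := ltnP u l; last first.
    by exists (0%N, set0); split; [exact: measurable0|].
  have [J [B [mB eB hB]]] := mu_miss_residue a01 hmu pl ol ul el.
  by exists (J, B).
pose J := maxn N (\max_(u < l) (JB u).1).
exists l, J, (B1 `|` \big[setU/set0]_(u < l) (JB u).2).
have mU : measurable (\big[setU/set0]_(u < l) (JB u).2).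
  by apply: bigsetU_measurable => u _; have [] := hJB u.
split => //.
- lia.
- exact: measurableU.
- rewrite (le_trans (measureU2 _ mB1 mU)) //.
  have -> : (e%:E = (e / 2)%:E + (e / 2)%:E)%E by rewrite -EFinD -splitr.
  rewrite leeD //.
  apply: (@le_trans _ _ (\sum_(u < l) mu (JB u).2)%E).
    by apply: (@Boole_inequality _ _ _ mu (fun u => (JB u).2)) => u _; have [] := hJB u.
  apply: (@le_trans _ _ (\sum_(u < l) (e / 2 / l%:R)%:E)%E).
    by apply: lee_sum => u _; have [_ /(_ (ltn_ord u)) []] := hJB u.
  rewrite sumEFin lee_fin sumr_const card_ord -[leLHS]mulr_natr divfK // gt_eqF //.
move=> x /not_orP[nB1 nU]; split; last first.
  by exists N; split => //; [exact: leq_maxl | exact: hN].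
move=> u ul; have [_ /(_ ul) [_ h]] := hJB u.
have [|j jJ hj] := h x.
  by move=> ux; apply: nU; rewrite -(bigcup_mkord l (fun u => (JB u).2)); exists u.
exists j => //; rewrite (leq_trans jJ) // (leq_trans _ (leq_maxr _ _)) //.
exact: (leq_bigmax (Ordinal ul)).
Qed.

(** * Transfer to multiples of an angle close to p/l *)

Lemma pascal_d_le (j : nat) (x : path_space) : (pascal_d j x <= 2 ^ j)%N.
Proof.
rewrite /pascal_d; have kj := pascal_k_le j x.
rewrite -[2%N]/(1 + 1)%N expnDn (bigD1 (inord (pascal_k j x))) //=.
by rewrite inordK ?ltnS // !exp1n !muln1 leq_addr.
Qed.

Lemma mod_solve (l p w : nat) : prime l -> ~~ (l %| p)%N ->
  exists2 u, (u < l)%N & (u * p = w %[mod l])%N.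
Proof.
move=> pl lp; pose v : 'F_l := w%:R / p%:R.
have p0 : p%:R != 0 :> 'F_l by rewrite -(dvdn_pcharf (pchar_Fp pl)).
exists (v : nat); first by rewrite -[X in (_ < X)%N](Fp_cast pl) ltn_ord.
rewrite -!(val_Fp_nat pl); congr val.
by rewrite natrM natr_Zp divfK.
Qed.

Section rotation.
Context {R : realType}.
Variables (K s l J p : nat) (theta : R) (x : path_space).
Hypotheses (pl : prime l) (lp : ~~ (l %| p)%N) (good : stage_good K s l J x).
Hypothesis near_theta : `|theta - p%:R / l%:R| < (2 ^+ J * l%:R)^-1.

Let l0 : 0 < l%:R :> R. Proof. by rewrite ltr0n prime_gt0. Qed.

Lemma pascal_d_approx (j : nat) : (j <= J)%N ->
  `|(pascal_d j x)%:R * theta - (pascal_d j x * p)%:R / l%:R| <= l%:R^-1.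
Proof.
move=> jJ; rewrite natrM -mulrA -mulrBr normrM normr_nat.
have dJ : (pascal_d j x)%:R <= 2 ^+ J :> R.
  by rewrite -natrX ler_nat (leq_trans (pascal_d_le j x)) // leq_exp2l.
rewrite (le_trans (ler_pM _ _ dJ (ltW near_theta))) //.
by rewrite invfM mulVKf // expf_neq0.
Qed.

(** Round [t] down to w/l and solve u p = w modulo [l]; some d_j is congruent to u. Rounding and
    approximation cost 1/l each; the naturals [u] and [v] of the statement encode an integer
    shift. *)
Lemma pascal_d_rotation (t : R) : 0 <= t -> exists j u v : nat,
  `|(pascal_d j x)%:R * theta + u%:R - v%:R - t| <= 2 / l%:R.
Proof.
move=> t0; pose w := Num.truncn (t * l%:R).
have [u ul uw] := mod_solve w pl lp.
have [j jJ ju] := good.1 u ul.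
set d := pascal_d j x in ju *.
have dw : ((d * p) %% l = w %% l)%N by rewrite -modnMml ju modnMml.
exists j, (w %/ l)%N, (d * p %/ l)%N; rewrite -/d.
have E : (d * p)%:R / l%:R + (w %/ l)%:R - (d * p %/ l)%:R = w%:R / l%:R :> R.
  rewrite [X in X%:R / _ + _](divn_eq _ l) dw [X in _ = X%:R / _](divn_eq _ l) !natrD !natrM.
  by field; rewrite gt_eqF.
have := pascal_d_approx jJ; rewrite -/d.
have /andP[tw1 tw2] : w%:R <= t * l%:R < w.+1%:R.
  by rewrite truncn_itv // mulr_ge0 // ltW.
have h1 : w%:R / l%:R <= t by rewrite ler_pdivrMr.
have h2 : t - l%:R^-1 <= w%:R / l%:R.
  by rewrite ler_pdivlMr // mulrBl mulVf ?gt_eqF // lerBlDr natr1 ltW.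
rewrite !ler_norml => /andP[h3 h4]; apply/andP; split; lra.
Qed.

Lemma pascal_d_return (j : nat) : (j <= J)%N -> (l %| pascal_d j x)%N ->
  exists v : nat, `|(pascal_d j x)%:R * theta - v%:R| <= l%:R^-1.
Proof.
move=> jJ /dvdnP[v dv]; have := pascal_d_approx jJ; rewrite dv => h.
exists (v * p)%N; move: h; rewrite mulnAC [X in _ - X / _]natrM mulfK // gt_eqF //.
Qed.

End rotation.

(** * The circle and its parametrization *)

Section circle.
Context {R : realType}.
Implicit Types (t : R) (u v : nat).

Lemma e2piDn t u : e2pi (t + u%:R) = e2pi t.
Proof.
rewrite /e2pi mulrDr (_ : 2 * pi * u%:R = (pi *+ 2) *+ u); last first.
  by rewrite mulr_natr mulr_natl.
by congr Complex; apply: periodicn; [exact: cosD2pi|exact: sinD2pi].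
Qed.

Lemma e2piDBn t u v : e2pi (t + u%:R - v%:R) = e2pi t.
Proof. by rewrite -(e2piDn _ v) subrK e2piDn. Qed.

Lemma norm_e2pi t : `|e2pi t| = 1.
Proof. by rewrite /e2pi normc_def cos2Dsin2 sqrtr1. Qed.

Lemma circle_e2pi (z : R[i]^o) : circle z -> exists2 t, 0 <= t & z = e2pi t.
Proof.
case: z => x y; rewrite /circle /= normc_def => -[] /(congr1 (fun r => r ^+ 2)).
rewrite sqr_sqrtr ?addr_ge0 ?sqr_ge0 // expr1n => xy.
have x1 : -1 <= x <= 1.
  by rewrite -ler_norml -(@ler_pXn2r _ 2) ?nnegrE // expr1n real_normK ?num_real //; nra.
have p2 : 2 * pi != 0 :> R by rewrite mulf_neq0 ?gt_eqF ?pi_gt0.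
have cx : cos (acos x) = x by rewrite acosK // in_itv.
have sx : sin (acos x) = `|y|.
  by rewrite sin_acos // -xy [x ^+ 2 + _]addrC addrK sqrtr_sqr.
have [y0|y0] := leP 0 y.
  exists (acos x / (2 * pi)); first by rewrite divr_ge0 ?acos_ge0 ?mulr_ge0 ?pi_ge0.
  by rewrite /e2pi mulrCA mulfV // mulr1 cx sx ger0_norm.
(* On the lower half circle a full turn is added, to keep the parameter nonnegative as
   [pascal_d_rotation] requires. *)
exists (- (acos x / (2 * pi)) + 1%:R).
  rewrite addrC subr_ge0 ler_pdivrMr ?mulr_gt0 ?pi_gt0 // mul1r.
  by rewrite (le_trans (acos_lepi _)) // ler_peMl ?pi_ge0 // ler1n.
rewrite e2piDn /e2pi mulrN mulrCA mulfV // mulr1 cosN sinN cx sx.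
by rewrite ltr0_norm // opprK.
Qed.

Lemma e2pi_nbhs t (B : set R[i]^o) : nbhs (e2pi t) B ->
  exists2 e, 0 < e & forall t', `|t' - t| <= e -> B (e2pi t').
Proof.
move=> /nbhs_ballP[r /= r0 rB].
(* Balls in [R[i]] have radii in [R[i]]; positivity forces the radius to be real. *)
have [r1 r1r] : exists r1 : R, r = r1%:C%C.
  by exists (complex.Re r); case: r r0 {rB} => a b; rewrite ltcE /= => /andP[/eqP -> _].
have {r0}r0 : 0 < r1 by move: r0; rewrite r1r ltcR.
have r2 : 0 < r1 / 2 by rewrite divr_gt0.
have cont (f : R -> R) : continuous f ->
    \forall t' \near t, `|f (2 * pi * t) - f (2 * pi * t')| < r1 / 2.
  move=> cf; have : (fun s => f (2 * pi * s)) s @[s --> t] --> f (2 * pi * t).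
    apply: continuous_comp; last exact: cf.
    exact: mulrl_continuous.
  by move=> /cvgrPdist_lt /(_ _ r2).
have : \forall t' \near t, B (e2pi t').
  near=> t'; apply: rB; rewrite -ball_normE /ball_ /= r1r /e2pi.
  have hc : `|cos (2 * pi * t) - cos (2 * pi * t')| < r1 / 2.
    by near: t'; apply: cont; exact: continuous_cos.
  have hs : `|sin (2 * pi * t) - sin (2 * pi * t')| < r1 / 2.
    by near: t'; apply: cont; exact: continuous_sin.
  rewrite normc_def ltcR.
  set c := cos _ - cos _ in hc *; set s := sin _ - sin _ in hs *.
  rewrite -[ltRHS]gtr0_norm // -sqrtr_sqr ltr_sqrt ?exprn_gt0 //.
  have sq (b : R) : `|b| < r1 / 2 -> b ^+ 2 < (r1 / 2) ^+ 2.
    by move=> hb; rewrite -[b ^+ 2]real_normK ?num_real // ltr_pXn2r ?nnegrE // ltW.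
  have := exprn_gt0 2 r0; have := sq _ hc; have := sq _ hs; rewrite -[complex.Re _]/c -[complex.Im _]/s expr_div_n; lra.
move=> /nbhs_ballP[e /= e0 eB]; exists (e / 2); first by rewrite divr_gt0.
move=> t' tt'; apply: eB; rewrite -ball_normE /ball_ /= distrC (le_lt_trans tt') //.
by rewrite ltr_pdivrMr // ltr_pMr // ltr1n.
Unshelve. all: end_near. Qed.

End circle.

(** * Borel-Cantelli and the generic angles *)

Lemma lim_sup_set_null {R : realType} (mu : probability path_space R)
    (B : nat -> set path_space) : (forall s, measurable (B s)) ->
  (forall s, (mu (B s) <= (1 / (2 ^ s.+1)%:R)%:E)%E) -> mu (lim_sup_set B) = 0%E.
Proof.
move=> mB eB; apply: lim_sup_set_cvg0 => //.
apply: le_lt_trans (ltry 1); apply: le_trans (epsilon_trick0 xpredT ler01).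
by apply: lee_nneseries => // s _; exact: eB.
Qed.

Section well_approximable.
Context {R : realType}.
Variables l J : nat -> nat.
Hypotheses (pl : forall s, prime (l s)) (sl : forall s, (s < l s)%N).

                                                                               
                                                                                   
(** The negative reals are included to make the set dense in the whole line, where Baire is applied,
    since the fractions used are nonnegative. Excluding multiples of [l] keeps multiplication by p
    invertible modulo [l]. *)
Definition well_approx (n : nat) : set R :=
  [set theta | theta < 0] `|`
  \bigcup_(sp in [set sp | (n <= sp.1)%N /\ ~~ (l sp.1 %| sp.2)%N])
    ball (sp.2%:R / (l sp.1)%:R : R) (2 ^+ J sp.1 * (l sp.1)%:R)^-1.

Lemma open_well_approx n : open (well_approx n).
Proof.
apply: openU; first exact: open_lt.
by apply: bigcup_open => sp _; exact: ball_open.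
Qed.

Lemma dense_well_approx n : dense (well_approx n : set R^o).
Proof.
move=> O [t Ot] oO.
have /nbhs_ballP[e /= e0 eO] : nbhs t O by exact: open_nbhs_nbhs.
have [t0|t0] := ltP t 0; first by exists t; split => //; left.
pose s := (n + Num.bound (2 / e))%N.
have l0 : 0 < (l s)%:R :> R by rewrite ltr0n prime_gt0.
have l1 := prime_gt1 (pl s).
have le : 2 / (l s)%:R < e.
  rewrite ltr_pdivrMr // mulrC -ltr_pdivrMr //.
  apply: (lt_trans (archi_boundP _)); first by rewrite divr_ge0 // ltW.
  by rewrite ltr_nat (leq_ltn_trans _ (sl s)) // leq_addl.
pose w := Num.truncn (t * (l s)%:R).
have /andP[tw1 tw2] : w%:R <= t * (l s)%:R < w.+1%:R.
  by rewrite truncn_itv // mulr_ge0 // ltW.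
(* Of two consecutive integers, at most one is a multiple of [l s]; hence the tolerance 2/l. *)
have [p lp /andP[wp pw]] : exists2 p, ~~ (l s %| p)%N & (w < p <= w.+2)%N.
  have [d|d] := boolP (l s %| w.+1)%N; last by exists w.+1 => //; rewrite ltnSn leqnSn.
  exists w.+2; last by rewrite leqnn leqnSn.
  by rewrite -addn1 dvdn_addr // dvdn1 gtn_eqF.
exists (p%:R / (l s)%:R); split.
  apply: eO; rewrite -ball_normE /ball_ /= distrC (le_lt_trans _ le) //.
  have -> : p%:R / (l s)%:R - t = (p%:R - t * (l s)%:R) / (l s)%:R.
    by rewrite mulrBl mulfK // gt_eqF.
  rewrite normrM normfV (gtr0_norm l0) ler_wpM2r ?invr_ge0 ?(ltW l0) //.
  have : w.+1%:R <= p%:R :> R by rewrite ler_nat.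
  have : p%:R <= w%:R + 2 :> R by rewrite -natrD addn2 ler_nat.
  by move=> ? ?; rewrite ler_norml; lra.
right; exists (s, p) => /=; first by rewrite leq_addr.
by apply: ballxx; rewrite invr_gt0 mulr_gt0 // exprn_gt0.
Qed.

Lemma Gdelta_well_approx :
  Gdelta (`[0%R, 1%R[ `&` \bigcap_n well_approx n : set (subspace `[0%R, 1%R[)).
Proof.
exists (fun n => `[0%R, 1%R[ `&` well_approx n).
  move=> n; apply/open_subspaceP; exists (well_approx n); first exact: open_well_approx.
  by rewrite [RHS]setIAC setIid setIC.
apply/seteqP; split => [x [x01 xV] n _|x xV]; first by split=> //; exact: xV.
by split=> [|n _]; [have [] := xV 0%N Logic.I|have [] := xV n Logic.I].
Qed.

Lemma dense_in_well_approx :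
  dense_in (`[0, 1[ `&` \bigcap_n well_approx n) `[0, 1[.
Proof.
split; first by move=> ? [].
move=> t; rewrite /= in_itv /= => /andP[t0 t1] B /nbhs_ballP[e /= e0 eB].
(* Keeps the interval from [t] to [t + r] inside both the given ball and [0,1), so that Baire yields
   a point of the right set. *)
pose r := Num.min e (1 - t).
have r0 : 0 < r by rewrite lt_min e0 subr_gt0.
have [re r1] : r <= e /\ r <= 1 - t by rewrite !ge_min !lexx orbT.
have [theta [th1 thV]] : `]t, (t + r)[%classic `&` (\bigcap_n well_approx n) !=set0.
  apply: (@Baire R R^o).
  - by move=> n; split; [exact: open_well_approx|exact: dense_well_approx].
  - exists (t + r / 2); rewrite /= in_itv /=; apply/andP; split; lra.
  - exact: interval_open.
move: th1; rewrite /= in_itv /= => /andP[h1 h2].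
exists theta; split.
  split=> //; rewrite /= in_itv /=; apply/andP; split; lra.
by apply: eB; rewrite -ball_normE /ball_ /= distrC gtr0_norm; lra.
Qed.

End well_approximable.
Theorem theorem5p4 (R : realType) (alpha : R) (halpha : 0 < alpha < 1)
    (mu : probability path_space R) (hmu : is_bernoulli alpha mu) :
  exists (Lambda : set R) (Y : set path_space),
    [/\ Gdelta (Lambda : set (subspace `[0%R, 1%R[)),
        dense_in Lambda `[0, 1[,
        measurable Y,
        mu Y = 1%E &
        forall (theta : R) (x : path_space), Lambda theta -> Y x ->
          dense_in [set e2pi ((pascal_d j x)%:R * theta) | j in [set: nat]]
            (@circle R) /\
          ~ unif_distributed_circle
              (fun j : nat => e2pi ((pascal_d j x)%:R * theta))].
Proof.
have [K [K0 hK]] := bernoulli_stage halpha hmu.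
have e_gt0 s : 0 < 1 / (2 ^ s.+1)%:R :> R by rewrite divr_gt0 ?ltr0n ?expn_gt0.
have /boolp.choice[f hf] : forall s : nat, exists f : nat * nat * set path_space,
    [/\ prime f.1.1, (s < f.1.1)%N, measurable f.2,
      (mu f.2 <= (1 / (2 ^ s.+1)%:R)%:E)%E &
      forall x, ~ f.2 x -> stage_good K s f.1.1 f.1.2 x].
  by move=> s; have [l [J [B ?]]] := hK s _ (e_gt0 s); exists (l, J, B).
pose l s := (f s).1.1; pose J s := (f s).1.2; pose B s := (f s).2.
have pl s : prime (l s) by have [] := hf s.
have sl s : (s < l s)%N by have [] := hf s.
have mB s : measurable (B s) by have [] := hf s.
have eB s : (mu (B s) <= (1 / (2 ^ s.+1)%:R)%:E)%E by have [] := hf s.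
have gB s x : ~ B s x -> stage_good K s (l s) (J s) x by have [_ _ _ _] := hf s; exact.
have mL : measurable (lim_sup_set B).
  by apply: bigcapT_measurable => n; apply: bigcup_measurable.
exists (`[0%R, 1%R[ `&` \bigcap_n well_approx l J n), (~` lim_sup_set B).
split.
- exact: Gdelta_well_approx.
- exact: dense_in_well_approx.
- exact: measurableC.
- by rewrite probability_setC // (lim_sup_set_null mB eB) sube0.
move=> theta x [/= theta01 thetaV] Yx.
have theta0 : 0 <= theta by move: theta01; rewrite in_itv /= => /andP[].
(* Outside the limsup, [x] lies in only finitely many exceptional sets. *)
have [n0 n0x] : exists n0, forall s, (n0 <= s)%N -> ~ B s x.
  apply: contrapT => /forallNP h; apply: Yx => n _.
  have /existsNP[s /not_implyP[ns /contrapT Bs]] := h n.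
  by exists s.
have approx (N : nat) (eta : R) : 0 < eta -> exists s p, [/\ (N <= s)%N,
    stage_good K s (l s) (J s) x, ~~ (l s %| p)%N, (l s)%:R^-1 < eta &
    `|theta - p%:R / (l s)%:R| < (2 ^+ J s * (l s)%:R)^-1].
  move=> eta0; pose n := maxn (maxn N n0) (Num.bound eta^-1).
  case: (thetaV n Logic.I) => [/=|[[s p] [/= ns lp] th]].
    by rewrite ltNge theta0.
  exists s, p; split => //.
  - by rewrite (leq_trans _ ns) // /n -maxnA leq_maxl.
  - by apply/gB/n0x; rewrite (leq_trans _ ns) // /n maxnAC leq_maxr.
  - rewrite invf_plt ?posrE ?ltr0n ?prime_gt0 //.
    apply: (lt_le_trans (archi_boundP _)); first by rewrite invr_ge0 ltW.
    by rewrite ler_nat (leq_trans _ (ltnW (sl s))) // (leq_trans _ ns) // leq_maxr.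
  - by move: th; rewrite -ball_normE /ball_ /= distrC.
split.
  split; first by move=> _ [j _ <-]; rewrite /circle /= norm_e2pi.
  move=> z /circle_e2pi[t t0 ->] A /e2pi_nbhs[e e0 eA].
  have e2 : 0 < e / 2 by rewrite divr_gt0.
  have [s [p [_ good lp le th]]] := approx 0%N _ e2.
  have [j [u [v duv]]] := pascal_d_rotation (pl s) lp good th t0.
  exists (e2pi ((pascal_d j x)%:R * theta)); split; first by exists j.
  rewrite -(e2piDBn _ u v); apply: eA; apply: (le_trans duv); lra.
move=> ud.
have KR : 0 < K%:R :> R by rewrite ltr0n.
(* The arc from [-eta] to [eta] has length [2 * eta], so uniform distribution gives eventual
   frequencies below [3 * eta], whereas good stages give at least 1/K = [4 * eta] at arbitrarily
   late times. *)
pose eta : R := (4 * K%:R)^-1.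
have eta0 : 0 < eta by rewrite invr_gt0 mulr_gt0.
have etaK : eta * 4 = K%:R^-1 by rewrite /eta invfM mulrC mulVKf.
have eta1 : eta * 4 <= 1 by rewrite etaK invf_le1 // ler1n.
have /cvgrPdist_lt /(_ eta eta0) [N0 _ hN0] : _ :=
  ud (- eta) eta ltac:(lra) ltac:(lra).
have [s [p [sN [_ [N [sN' NJ NK]]] lp le th]]] := approx N0 _ eta0.
have := hN0 N (leq_trans sN (ltnW sN')).
set S : R := \sum_(j < N) _.
have N0R : 0 < N%:R :> R by rewrite ltr0n (leq_trans _ sN').
have : (\sum_(j < N) (l s %| pascal_d j x))%:R <= S.
  rewrite natr_sum; apply: ler_sum => j _; rewrite indicE ler_nat.
  have [d|//] := boolP (l s %| pascal_d j x)%N.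
  have [v dv] := pascal_d_return (pl s) th (leq_trans (ltnW (ltn_ord j)) NJ) d.
  (* This representative is at most 1/l < [eta] in absolute value, so it lies in the arc. *)
  rewrite mem_set //; exists ((pascal_d j x)%:R * theta - v%:R).
    by move: dv; rewrite /= in_itv /= ler_norml => /andP[? ?]; apply/andP; split; lra.
  by rewrite -[in RHS](e2piDBn _ 0 v) addr0.
move: NK; rewrite -(ler_nat R) natrM => NK /(ler_wpM2l (ltW KR)) /(le_trans NK) NS.
have : K%:R^-1 <= S / N%:R.
  by rewrite ler_pdivlMr // ler_pdivrMl.
by rewrite -etaK ltr_norml => ? /andP[? ?]; lra.
Qed.
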